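(* Let $s$ be a non-empty string over a finite alphabet $\Sigma$ containing exactly $\sigma$ distinct characters. Then there are at most $\sigma$ prefixes $w$ of $s$ such that $w$ is a parameterized square and $w$ has no parameterized occurrence in $s$ other than the one at position $1$ (i.e., there is no $i \ge 2$ with $i+|w|-1 \le |s|$ and $s[i..i+|w|-1] \approx w$).
   Context: Two strings $x,y$ of equal length $k$ over $\Sigma$ are parameterized equivalent, written $x \approx y$, if there is a bijection $f:\Sigma\to\Sigma$ with $f(x[i]) = y[i]$ for all $1 \le i \le k$. A string $w$ is a parameterized square if $w = xy$ for strings $x,y$ with $x \approx y$. For a string $s$, $s[i..j]$ denotes the substring from position $i$ to position $j$ (positions start at 1). *)

(* Defs.v *)
From mathcomp Require Import all_boot.

Set Implicit Arguments.
Unset Strict Implicit.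
Unset Printing Implicit Defensive.

(* Strings over Sigma are [seq Sigma]. The equation [map f x = y] forces       *)
(* [size x = size y], so strings of different lengths are never equivalent.    *)
Definition param_equiv (Sigma : finType) (x y : seq Sigma) : Prop :=
  exists2 f : Sigma -> Sigma, bijective f & map f x = y.

Definition param_square (Sigma : finType) (w : seq Sigma) : Prop :=
  exists x y : seq Sigma, w = x ++ y /\ param_equiv x y.

(* s[i..j], with positions starting at 1 and both ends included; it is empty  *)
(* when j = i - 1.                                                            *)
Definition substr (Sigma : finType) (s : seq Sigma) (i j : nat) : seq Sigma :=
  drop i.-1 (take j s).

Definition param_occurs_at (Sigma : finType) (w s : seq Sigma) (i : nat) : Prop :=
  [/\ 1 <= i, i + size w - 1 <= size s
    & param_equiv (substr s i (i + size w - 1)) w].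

(* Main.v *)
Require Import Defs.
From mathcomp Require Import all_boot all_fingroup zify.

Set Implicit Arguments.
Unset Strict Implicit.
Unset Printing Implicit Defensive.

(* Let [l_0 < ... < l_k] be the half-lengths of the squares, [f_j] the         *)
(* permutation taking the left half of the [j]-th square to its right half,    *)
(* and suppose [k = sigma]. Since the smallest square does not recur at        *)
(* [l_k], [l_k < 2 l_0]. Let [p = l_(i+1) - l_i] be the smallest gap. Then     *)
(* [h = f_i^-1 f_(i+1)] shifts the prefix of length [l_i] by [p], and more     *)
(* generally [f_j^-1 f_(j+1)] shifts the prefix of length [l_j] by             *)
(* [l_(j+1) - l_j]. A prefix of length [t p] contains at least [t] letters or  *)
(* all letters of the period, and the gaps sum up to at least [sigma p], so    *)
(* overlapping shifts show that [h] commutes with each [f_j^-1 f_(j+1)], and   *)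
(* then with [f_0], except perhaps on two letters; comparing signatures, it    *)
(* commutes everywhere. Hence [h] commutes with [f_1] too, and gluing the      *)
(* periods shows that the smallest square recurs at distance [p].              *)

(** A square of half-length [l] is a prefix of length [2 l] that a permutation shifts by [l];
    occurrences elsewhere are such shifts too, so everything is phrased with [perm_period].
    [recurring_square] carries the contradiction. It rests on [letters_stab_commute], which turns
    commutation seen on a short prefix into commutation on all its letters, by counting
    ([letters_growth]) and parity ([eq_perm_parity]). *)

Definition perm_period (T : finType) (c : nat -> T) (u : {perm T}) (p m : nat) :=
  forall q, q + p < m -> c (q + p) = u (c q).

Definition letters (T : finType) (c : nat -> T) (m : nat) : {set T} :=
  [set c i | i : 'I_m].

Lemma lettersP (T : finType) (c : nat -> T) (m : nat) (x : T) :
  reflect (exists2 q, q < m & x = c q) (x \in letters c m).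
Proof.
apply: (iffP imsetP) => [[i _ ->]|[q ltqm ->]]; first by exists i.
by exists (Ordinal ltqm).
Qed.

Lemma mem_letters (T : finType) (c : nat -> T) (m q : nat) :
  q < m -> c q \in letters c m.
Proof. by move=> ltqm; apply/lettersP; exists q. Qed.

Lemma letters_sub (T : finType) (c : nat -> T) (m m' : nat) :
  m <= m' -> letters c m \subset letters c m'.
Proof.
move=> lemm'; apply/subsetP => x /lettersP[q ltqm ->].
exact/mem_letters/(leq_trans ltqm).
Qed.

(** * Permutations stabilizing a set of letters *)

Lemma stab_permP (T : finType) (A : {set T}) (u : {perm T}) :
  reflect {in A, forall x, u x \in A} (u \in 'N(A | 'P)%g).
Proof.
rewrite inE in_setT inE /=; apply: (iffP subsetP) => uA x Ax.
  by have := uA x Ax; rewrite inE.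
by rewrite inE; apply: uA.
Qed.

(** If [f] sends some [x] out of [S], counting gives some [y] outside that it sends into [S];
    neither lies in [X], so swapping their images repairs [x] and keeps [f] on [X]. This confines
    the permutations of squares to the letters of [s]. *)
Lemma stab_perm_extension (T : finType) (S X : {set T}) (f : {perm T}) :
  X \subset S -> {in X, forall x, f x \in S} ->
  exists2 g : {perm T}, g \in 'N(S | 'P)%g & {in X, g =1 f}.
Proof.
move=> sXS; have [n] := ubnP #|[set x in S | f x \notin S]|.
elim: n f => // n IHn f ltn fX.
have [/stab_permP fS|nfS] := boolP (f \in 'N(S | 'P)%g).
  by exists f => //; apply/stab_permP.
have [x Sx nSfx]: exists2 x, x \in S & f x \notin S.
  apply/exists_inP; apply: contraR nfS => /exists_inPn h.
  by apply/stab_permP => x Sx; have:= h x Sx; rewrite negbK.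
have [y nSy Sfy]: exists2 y, y \notin S & f y \in S.
  have: ~~ (S \subset f @: S).
    apply/negP => sS; case/negP: nSfx; have: f @: S == S.
      by rewrite eq_sym eqEcard sS card_imset ?leqnn //; apply: perm_inj.
    by move/eqP => <-; apply: imset_f.
  case/subsetPn => z Sz nz; exists (f^-1%g z); last by rewrite permKV.
  by apply: contra nz => h; apply/imsetP; exists (f^-1%g z); rewrite ?permKV.
have nXx: x \notin X by apply: contra nSfx; apply: fX.
have gX: {in X, (tperm x y * f)%g =1 f}.
  move=> z Xz; rewrite permM tpermD //; first by apply: contraNneq nXx => ->.
  by apply: contraNneq nSy => ->; apply: (subsetP sXS).
have [|z Xz|g gS gf] := IHn (tperm x y * f)%g.
- rewrite ltnS in ltn; apply: leq_trans ltn; apply/proper_card/properP; split.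
    apply/subsetP => z; rewrite !inE => /andP[Sz]; rewrite Sz permM /=.
    case: tpermP => [->|zy|//]; first by rewrite Sfy.
    by rewrite zy in Sz; rewrite Sz in nSy.
  by exists x; rewrite !inE ?Sx ?permM ?tpermL ?Sfy.
- by rewrite gX // fX.
by exists g => // z Xz; rewrite gf // gX.
Qed.

(** The quotient of [u] and [v] moves only points of [D], so it is the identity or a transposition;
    equal parity excludes the latter. *)
Lemma eq_perm_parity (T : finType) (u v : {perm T}) (D : {set T}) :
  odd_perm u = odd_perm v -> #|D| <= 2 ->
  {in [predC D], u =1 v} -> u = v.
Proof.
move=> uv D2 agree; apply/eqP; rewrite eq_mulgV1; apply/eqP.
set w := (u * v^-1)%g.
have wD x : x \notin D -> w x = x.
  by move=> Dx; rewrite permM agree ?permK.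
have [->//|w1] := eqVneq w 1%g.
have [x wx]: exists x, w x != x.
  apply/existsP; apply: contraR w1 => /existsPn h.
  by apply/eqP/permP => x; rewrite perm1; apply/eqP; have:= h x; rewrite negbK.
have wwx : w (w x) != w x by rewrite (inj_eq perm_inj).
have Dx: x \in D by apply: contraR wx => /wD ->.
have Dwx: w x \in D by apply: contraR wwx => /wD ->.
have DE: D = [set x; w x].
  apply/esym/eqP; rewrite eqEcard cards2 eq_sym wx D2 andbT.
  by apply/subsetP => z; rewrite !inE => /orP[]/eqP->.
suff wE: w = tperm x (w x).
  have := odd_tperm x (w x); rewrite -wE eq_sym wx odd_permM odd_permV uv.
  by rewrite addbb.
apply/permP => z; have [zD|zD] := boolP (z \in D); last first.
  rewrite wD // tpermD //; apply: contraNneq zD => <- //.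
have wwD: w (w x) \in D.
  by apply: contraR wwx => /wD /perm_inj ->.
have := zD; rewrite DE !inE => /orP[]/eqP->; rewrite ?tpermL ?tpermR //.
by move: wwD; rewrite DE !inE (negbTE wwx) orbF => /eqP.
Qed.

(* [v * h] and [h * v] have the same parity, so on [A] they cannot differ by a *)
(* transposition.                                                              *)
Lemma commute_on (T : finType) (A C : {set T}) (h v : {perm T}) :
  h \in 'N(A | 'P)%g -> v \in 'N(A | 'P)%g -> #|A :\: C| <= 2 ->
  {in C, forall x, v (h x) = h (v x)} -> {in A, forall x, v (h x) = h (v x)}.
Proof.
move=> hA vA small comm x Ax.
have hvA: (h * v)%g \in 'N(A | 'P)%g by rewrite groupM.
have vhA: (v * h)%g \in 'N(A | 'P)%g by rewrite groupM.
have E: restr_perm A (h * v)%g = restr_perm A (v * h)%g.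
  apply: (@eq_perm_parity _ _ _ (A :\: C)) => //.
    by rewrite !morphM // !odd_permM addbC.
  move=> y; rewrite !inE negb_and negbK => Cy.
  have [Ay|nAy] := boolP (y \in A); last by rewrite !(out_perm (restr_perm_on _ _)).
  by rewrite !restr_permE // !permM comm //; move: Cy; rewrite Ay orbF.
by have := congr1 (fun u : {perm T} => u x) E; rewrite !restr_permE // !permM.
Qed.

(* Until the letters of a prefix form a set closed under [h], each further [p] *)
(* positions bring in a new letter.                                            *)
Lemma letters_growth (T : finType) (c : nat -> T) (h : {perm T}) (p m t : nat) :
  0 < p -> perm_period c h p m -> t * p <= m ->
  minn #|letters c m| t <= #|letters c (t * p)|.
Proof.
move=> p0 per; elim: t => [|t IHt] tpm; first by rewrite minn0.
have sub : letters c (t * p) \subset letters c (t.+1 * p).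
  by apply: letters_sub; rewrite leq_mul2r leqnSn orbT.
have {}IHt : minn #|letters c m| t <= #|letters c (t * p)|.
  by apply: IHt; apply: leq_trans tpm; rewrite leq_mul2r leqnSn orbT.
have [t0|t0] := posnP t.
  rewrite t0 mul1n; apply: leq_trans (geq_minr _ _) _.
  by apply/card_gt0P; exists (c 0); apply: mem_letters.
have [E|ne] := eqVneq (letters c (t * p)) (letters c (t.+1 * p)); last first.
  have : #|letters c (t * p)| < #|letters c (t.+1 * p)|.
    by apply: proper_card; rewrite properEneq ne.
  by move: IHt; rewrite !geq_min; lia.
rewrite -E; apply: leq_trans (geq_minl _ _) _; apply: subset_leq_card.
apply/subsetP => _ /lettersP[q qm ->].
elim/ltn_ind: q qm => q IHq qm.
have [lt|ge] := ltnP q (t.+1 * p); first by rewrite E; apply: mem_letters.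
have qp : q = q - p + p by rewrite subnK //; apply: leq_trans ge; rewrite leq_pmull.
have /lettersP[r rt cr] : c (q - p) \in letters c (t * p) by apply: IHq; lia.
rewrite qp per -?qp // cr -per; last by rewrite mulSn in tpm; lia.
by rewrite E; apply: mem_letters; rewrite mulSn; lia.
Qed.

Lemma period_mem (T : finType) (c : nat -> T) (A : {set T}) (v : {perm T})
    (e l m : nat) :
  0 < e <= l -> v \in 'N(A | 'P)%g -> {in gtn l, forall q, c q \in A} ->
  perm_period c v e m -> {in gtn m, forall q, c q \in A}.
Proof.
case/andP=> e0 el /stab_permP vA cA per q; elim/ltn_ind: q => q IHq qm.
rewrite inE /= in qm.
have [lt|ge] := ltnP q l; first exact: cA.
have qe : q = q - e + e by lia.
by rewrite qe per -?qe //; apply/vA/IHq; rewrite ?inE /=; lia.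
Qed.

Lemma gap_sum (L : nat -> nat) (p a b n : nat) :
  (forall j, j < n -> L j + p <= L j.+1) -> a <= b <= n ->
  L a + (b - a) * p <= L b.
Proof.
move=> gap /andP[ab bn]; elim: b ab bn => [|b IHb] ab bn.
  by have -> : a = 0; lia.
have [->|ne] := eqVneq a b.+1; first by rewrite subnn; lia.
have := IHb _ (ltnW bn); have := gap b bn; rewrite subSn ?mulSn; lia.
Qed.

(** Unless [letters c m] is all of [S], the first [#|S|.-1 * p] positions exhaust it, so images
    there decide stability. The first [#|S|.-2 * p] positions miss at most two of its letters, which
    [commute_on] tolerates. *)
Lemma letters_stab_commute (T : finType) (c : nat -> T) (S : {set T})
    (h v : {perm T}) (p m : nat) :
  0 < p -> perm_period c h p m -> #|S| * p <= m ->
  letters c m \subset S ->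
  h \in 'N(S | 'P)%g -> v \in 'N(S | 'P)%g ->
  (forall q, q < #|S|.-1 * p -> v (c q) \in letters c m) ->
  (forall q, q < #|S|.-2 * p -> v (h (c q)) = h (v (c q))) ->
  v \in 'N(letters c m | 'P)%g
  /\ {in letters c m, forall x, v (h x) = h (v x)}.
Proof.
move=> p0 per Spm sub hS vS vin vcomm; set A := letters c m.
have growth t : t <= #|S| -> minn #|A| t <= #|letters c (t * p)|.
  move=> tS; apply: (letters_growth p0 per).
  by apply: leq_trans Spm; rewrite leq_mul2r tS orbT.
have sA t : t <= #|S| -> letters c (t * p) \subset A.
  by move=> tS; apply/letters_sub/(leq_trans _ Spm); rewrite leq_mul2r tS orbT.
have stab u : u \in 'N(S | 'P)%g ->
    (forall q, q < #|S|.-1 * p -> u (c q) \in A) -> u \in 'N(A | 'P)%g.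
  move=> uS uin; have [SA|AS] := leqP #|S| #|A|.
    suff -> : A = S by [].
    by apply/eqP; rewrite eqEcard sub.
  have E : letters c (#|S|.-1 * p) = A.
    have := growth _ (leq_pred #|S|); have := sA _ (leq_pred #|S|) => s1 s2.
    by apply/eqP; rewrite eqEcard s1; apply: leq_trans s2; lia.
  apply/stab_permP => x; rewrite -{1}E => /lettersP[q lt ->].
  exact: uin.
have vA := stab v vS vin; split=> //.
have hA : h \in 'N(A | 'P)%g.
  apply: stab => // q lt; have [S0|S0] := posnP #|S|.
    by rewrite S0 in lt.
  have lt' : q + p < m.
    by apply: leq_trans Spm; rewrite -(prednK S0) mulSn; lia.
  by rewrite -per //; apply: mem_letters.
apply: (@commute_on _ _ (letters c (#|S|.-2 * p))) => //.
  have s2 : #|S|.-2 <= #|S| by lia.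
  rewrite cardsD (setIidPr (sA _ s2)); have := growth _ s2.
  by have := subset_leq_card sub; rewrite -/A; lia.
by move=> x /lettersP[q lt ->]; apply: vcomm.
Qed.

(** * Recurrence of the smallest square *)

Lemma recurring_square (T : finType) (c : nat -> T) (S : {set T})
    (L : nat -> nat) (f : nat -> {perm T}) (p i : nat) :
  1 < #|S| -> 0 < p -> i < #|S| -> L i.+1 = L i + p ->
  (forall j, j < #|S| -> L j + p <= L j.+1) ->
  L #|S| < (L 0).*2 ->
  (forall q, q < (L #|S|).*2 -> c q \in S) ->
  (forall j, j <= #|S| -> f j \in 'N(S | 'P)%g) ->
  (forall j, j <= #|S| -> perm_period c (f j) (L j) (L j).*2) ->
  exists h : {perm T}, perm_period c h p ((L 0).*2 + p).
Proof.
set sigma := #|S| => S1 p0 iS Li gap L2 cS fS fper.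
have sum a b : a <= b <= sigma -> L a + (b - a) * p <= L b by apply: gap_sum gap.
have mono a b : a <= b <= sigma -> L a <= L b by move=> /sum; apply: leq_trans; apply: leq_addr.
(* Products act left to right: [H j] applies [f j.+1], then the inverse of [f j], hence shifts by
   the gap between the half-lengths. *)
pose H j := (f j.+1 * (f j)^-1)%g.
have HS j : j < sigma -> H j \in 'N(S | 'P)%g.
  by move=> lt; rewrite groupM ?groupV ?fS // ltnW.
have Hper j : j < sigma -> perm_period c (H j) (L j.+1 - L j) (L j).
  move=> lt q lq; have g := gap j lt.
  apply: (@perm_inj _ (f j)); rewrite permM permKV -!fper ?(ltnW lt) //; last 2 first.
  - lia.
  - lia.
  by congr c; lia.
pose h := H i; have hper : perm_period c h p (L i).
  by have := Hper i iS; rewrite Li addKn.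
have perW u e m m' : m <= m' -> perm_period c u e m' -> perm_period c u e m.
  by move=> mm per q lt; apply: per; lia.
pose A := letters c (L 0).
have hper0 : perm_period c h p (L 0) by apply: perW hper; apply: mono; lia.
have sp : sigma * p < L 0 by have := sum 0 sigma (leqnn _); rewrite subn0; lia.
have sA : A \subset S.
  apply/subsetP => x /lettersP[q lt ->]; apply: cS.
  by have := mono 0 sigma (leqnn _); lia.
(* All gaps but the [j]-th sum up to at least [(sigma - 1) * p]. *)
have room j : j < sigma -> (L j.+1 - L j) + sigma.-1 * p < L 0.
  move=> lt; have := sum 0 j (ltnW lt); have := sum j.+1 sigma; rewrite lt leqnn => /(_ isT).
  have : (sigma - j.+1) * p + (j - 0) * p = sigma.-1 * p.
    by rewrite -mulnDl; congr (_ * _); lia.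
  have := gap j lt; lia.
have pred2 : sigma.-1 * p = p + sigma.-2 * p by rewrite -mulSn; congr (_ * _); lia.
have stabcomm v := @letters_stab_commute _ c S h v p (L 0) p0 hper0 (ltnW sp) sA
   (HS i iS).
have HA j : j < sigma -> H j \in 'N(A | 'P)%g /\ {in A, forall x, H j (h x) = h (H j x)}.
  move=> lt; have r := room j lt; have per := Hper j lt.
  have L0j : L 0 <= L j by apply: mono; lia.
  apply: stabcomm; first exact: HS.
    by move=> q ltq; rewrite -per; [apply: mem_letters|]; lia.
  move=> q ltq; rewrite -hper0; last lia.
  rewrite -!per; [|lia|lia].
  by rewrite -hper0; [congr c|]; lia.
(* The last shift, by [e], commutes with [h] on [A]; since [e + p < L 0], stepping back by [e]
   extends the period [p] from length [L 0] to length [M]. *)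
set e := L sigma - L sigma.-1; set M := L sigma.-1.
have pS : p <= sigma.-1 * p by rewrite leq_pmull //; lia.
have sK : sigma.-1.+1 = sigma by rewrite prednK // ltnW.
have eP : 0 < e /\ e + p < L 0.
  have := room sigma.-1; have := gap sigma.-1; rewrite sK leqnn -/M -/e.
  by move=> /(_ isT) g /(_ isT) r; rewrite subn_gt0; lia.
have [h1A h1c] := HA sigma.-1 ltac:(lia).
have h1per := Hper sigma.-1 ltac:(lia).
rewrite sK -/e -/M in h1per.
have cA q : q < M -> c q \in A.
  apply: (@period_mem _ c A _ e (L 0) M) h1A _ h1per q; first lia.
  by move=> q; apply: mem_letters.
have hperM : perm_period c h p M.
  move=> q; elim/ltn_ind: q => q IHq lt.
  have [lt0|ge0] := ltnP (q + p) (L 0); first exact: hper0.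
  have qe : q = q - e + e by lia.
  have -> : q + p = q - e + p + e by lia.
  rewrite h1per; last lia.
  rewrite IHq; [|lia|lia].
  rewrite h1c; last by apply: cA; lia.
  by rewrite -h1per -?qe //; lia.
(* Thus [f 0] sends the first [sigma.-1 * p] letters to letters read before [M], which lie in
   [A]. *)
have M0 : L 0 + sigma.-1 * p <= M by have := sum 0 sigma.-1 (leq_pred _); rewrite subn0.
have [f0A f0c] : f 0 \in 'N(A | 'P)%g /\ {in A, forall x, f 0 (h x) = h (f 0 x)}.
  have per := fper 0 (leq0n _).
  apply: stabcomm; first exact: fS.
    by move=> q ltq; rewrite -per; [apply: cA|]; lia.
  move=> q ltq; rewrite -hper0; last lia.
  rewrite -!per; [|lia|lia].
  by rewrite -hperM; [congr c|]; lia.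
have [H0A H0c] := HA 0 ltac:(lia).
have f1E x : f 1 x = f 0 (H 0 x) by rewrite permM permKV.
have f1c : {in A, forall x, f 1 (h x) = h (f 1 x)}.
  move=> x Ax; rewrite !f1E H0c // f0c //.
  by move/stab_permP: H0A; apply.
have M1 : L 1 <= M by apply: mono; lia.
(* The period [p] of the left half of a square is carried by [f j] to its right half. *)
have shifted j : j <= 1 -> {in A, forall x, f j (h x) = h (f j x)} ->
    forall q, L j <= q -> q + p < (L j).*2 -> c (q + p) = h (c q).
  move=> j1 fc q ge lt; have per := fper j ltac:(lia).
  have Lj1 : L j <= L 1 by apply: mono; lia.
  have qj : q = q - L j + L j by lia.
  have -> : q + p = q - L j + p + L j by lia.
  rewrite per; last lia.
  rewrite hperM; last lia.
  rewrite fc; last by apply: cA; lia.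
  by rewrite -per -?qj //; lia.
(* These give [L 1 + p < 2 L 0] and [2 L 0 + p <= 2 L 1]: the last [p] positions, even stepped back
   by [p], lie in the right half of the second square. *)
have r0 := room 0 ltac:(lia); have g0 := gap 0 ltac:(lia).
exists h => q lt.
have [lt1|ge1] := ltnP (q + p) M; first exact: hperM.
have [lt2|ge2] := ltnP (q + p) (L 0).*2; first by apply: (shifted 0) => //; lia.
by apply: (shifted 1) => //; lia.
Qed.

(** * From strings to periods, and the final contradiction *)

Lemma prefix_square (Sigma : finType) (s w : seq Sigma) (x0 : Sigma) :
  prefix w s -> param_square w ->
  exists f : {perm Sigma}, [/\ size w = (size w)./2.*2, size w <= size s
    & perm_period (nth x0 s) f (size w)./2 (size w)].
Proof.
move=> /prefixP[t ->] [x [y [-> [f /bij_inj finj <-]]]].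
exists (perm finj); rewrite size_cat size_map addnn doubleK.
split=> //; first by rewrite !size_cat size_map; lia.
move=> q lt; have qx : q < size x by lia.
rewrite permE -!catA !nth_cat size_map qx ltnNge leq_addl /= addnK qx.
by rewrite (nth_map x0).
Qed.

Lemma period_occurs (Sigma : finType) (s w : seq Sigma) (x0 : Sigma)
    (h : {perm Sigma}) (d : nat) :
  prefix w s -> size w + d <= size s ->
  perm_period (nth x0 s) h d (size w + d) -> param_occurs_at w s d.+1.
Proof.
move=> pw le per; have e : d.+1 + size w - 1 = size w + d by lia.
split; rewrite ?e // /substr /=.
have sz : size (drop d (take (size w + d) s)) = size w.
  by rewrite size_drop size_takel // addnK.
(* [h] sends [w] to its shifted copy, while [param_occurs_at] asks for a map from the copy to
   [w]. *)
exists (h^-1)%g; first by exists h => x; rewrite ?permK ?permKV.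
apply: (@eq_from_nth _ x0); rewrite size_map sz // => q lt.
rewrite (nth_map x0) ?sz // nth_drop nth_take; last by lia.
rewrite addnC per ?permK; last by lia.
by case/prefixP: pw => t ->; rewrite nth_cat lt.
Qed.

Theorem theorem7 (Sigma : finType) (s : seq Sigma) (sigma : nat)
    (s_nonempty : s <> [::]) (card_s : size (undup s) = sigma)
    (ws : seq (seq Sigma)) (ws_uniq : uniq ws)
    (wsP : forall w : seq Sigma, w \in ws ->
       [/\ prefix w s, param_square w
         & ~ (exists i : nat, 2 <= i /\ param_occurs_at w s i)]) :
  size ws <= sigma.
Proof.
rewrite leqNgt; apply/negP => many.
have [x0 x0s] : exists x0, x0 \in s.
  by case: (s) s_nonempty => // x s' _; exists x; rewrite mem_head.
pose S := [set x in s].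
have cardS : #|S| = sigma.
  rewrite cardsE -card_s -(card_uniqP (undup_uniq s)).
  by apply: eq_card => x; rewrite mem_undup.
have sigma0 : 0 < sigma by rewrite -cardS; apply/card_gt0P; exists x0; rewrite inE.
pose c := nth x0 s.
pose half (w : seq Sigma) := (size w)./2.
have square w : w \in ws -> exists f : {perm Sigma},
    [/\ size w = (half w).*2, size w <= size s & perm_period c f (half w) (size w)].
  by move=> /wsP[pw sw _]; apply: prefix_square.
have half_inj : {in ws &, injective half}.
  move=> v w vws wws e; have [_ [v2 _ _]] := square v vws.
  have [_ [w2 _ _]] := square w wws.
  have [/prefixP[t st] _ _] := wsP v vws; have [/prefixP[t' st'] _ _] := wsP w wws.
  have evw : size v = size w by rewrite v2 w2 e.
  by rewrite -(take_size_cat t (erefl (size v))) -st st' evw take_size_cat.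
pose ls := sort leq (map half ws).
have sz : size ls = size ws by rewrite size_sort size_map.
have ls_sorted : sorted ltn ls.
  rewrite ltn_sorted_uniq_leq sort_uniq map_inj_in_uniq // ws_uniq.
  exact: sort_sorted leq_total _.
(* Only the indices up to [sigma] matter; they are in range, so the default 0 is never read. *)
pose L j := nth 0 ls j.
have Lmono a b : a < b -> b <= sigma -> L a < L b.
  by move=> ab bs; apply: (sorted_ltn_nth ltn_trans) => //; rewrite inE sz; lia.
have Lws j : j <= sigma -> exists2 w, w \in ws & half w = L j.
  move=> js; have : L j \in map half ws by rewrite -(mem_sort leq) mem_nth // sz; lia.
  by case/mapP => w wws ->; exists w.
have cS q : q < size s -> c q \in S by move=> lt; rewrite inE mem_nth.
have Ls j : j <= sigma -> (L j).*2 <= size s.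
  by case/Lws => w /square[f [w2 le _]] <-; rewrite -w2.
have Lsquare j : j <= sigma ->
    exists f : {perm Sigma}, f \in 'N(S | 'P)%g /\ perm_period c f (L j) (L j).*2.
  move=> js; have le := Ls j js.
  have [w /square[f [w2 _ per]] Lw] := Lws j js; rewrite w2 Lw in per.
  have := @stab_perm_extension _ S (letters c (L j)) f.
  case=> [||g gS gf].
  - by apply/subsetP => _ /lettersP[q lt ->]; apply: cS; lia.
  - by move=> _ /lettersP[q lt ->]; rewrite -per; [apply: cS|]; lia.
  exists g; split=> // q lt; rewrite gf ?per //.
  by apply: mem_letters; lia.
have Lunique j d h : j <= sigma -> 0 < d -> (L j).*2 + d <= size s ->
    ~ perm_period c h d ((L j).*2 + d).
  move=> js d0 le per; have [w wws Lw] := Lws j js.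
  have [pw _ []] := wsP w wws; exists d.+1; split=> //.
  have [_ [w2 _ _]] := square w wws.
  by apply: (period_occurs (x0 := x0) (h := h)); rewrite ?w2 ?Lw.
(* Otherwise the left half of the square of index [sigma] contains the whole smallest square, which
   then recurs in the right half. *)
have L2 : L sigma < (L 0).*2.
  rewrite ltnNge; apply/negP => le; have := Ls sigma (leqnn _).
  have [f [_ per]] := Lsquare sigma (leqnn _) => le2.
  apply: (Lunique 0 (L sigma) f); try lia.
    by have := Lmono 0 sigma sigma0 (leqnn _); lia.
  by move=> q lt; apply: per; lia.
have [S1|S1] := leqP sigma 1.
  have s1 : sigma = 1 by lia.
  have lt : L 0 < L 1 by apply: Lmono; lia.
  have le : (L 1).*2 <= size s by apply: Ls; lia.
  apply: (Lunique 0 1 1%g) => // [|q ltq]; first lia.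
  have /eqP/cards1P[a Sa] : #|S| = 1 by rewrite cardS.
  have /set1P-> : c (q + 1) \in [set a] by rewrite -Sa cS //; lia.
  by have /set1P-> : c q \in [set a]; rewrite ?perm1 // -Sa cS //; lia.
have [f fP] : exists f : nat -> {perm Sigma}, forall j, j <= sigma ->
    f j \in 'N(S | 'P)%g /\ perm_period c (f j) (L j) (L j).*2.
  have [F FP] := fin_all_exists (fun j : 'I_sigma.+1 => Lsquare j (ltn_ord j)).
  by exists (fun j => F (inord j)) => j js; have := FP (inord j); rewrite inordK.
have [i gapi] : exists i : 'I_sigma, forall j : 'I_sigma,
    L i.+1 - L i <= L j.+1 - L j.
  pose i0 := Ordinal sigma0.
  case: (@arg_minnP _ i0 xpredT (fun j : 'I_sigma => L j.+1 - L j)) => // i _ iP.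
  by exists i => j; apply: iP.
have lti := Lmono i i.+1 (leqnn _) (ltn_ord i).
have [h hper] : exists h : {perm Sigma},
    perm_period c h (L i.+1 - L i) ((L 0).*2 + (L i.+1 - L i)).
  apply: (@recurring_square _ c S L f _ i); rewrite ?cardS //; try lia.
  - by move=> j lt; have := gapi (Ordinal lt); have := Lmono j j.+1 (leqnn _) lt => /=; lia.
  - by move=> q lt; apply: cS; have := Ls sigma (leqnn _); lia.
  - by move=> j /fP[].
  - by move=> j /fP[].
(* The smallest gap is at most [L 1 - L 0], so the new occurrence ends inside the second square,
   hence inside [s]. *)
have := gapi (Ordinal sigma0); have := Lmono 0 1 isT sigma0; rewrite /= => lt01 g0.
apply: Lunique hper; [lia|lia|].
by have := Ls 1 sigma0; lia.
Qed.
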